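(* Let $(\mathfrak{g},\pi)$ be a Lie algebra over $\mathbf{k}$, let $\mu,\lambda\in\mathbf{k}$, and let $T\in\mathrm{Hom}(\mathfrak{g},\mathfrak{g})$. Then $T$ is a Maurer-Cartan element of the curved dg Lie algebra $(\mathrm{Hom}(\bigwedge\mathfrak{g},\mathfrak{g}),d_0,d_1,d_2)$ (described in the context) if and only if $T$ is an extended Rota-Baxter operator of weight $(\mu,\lambda)$ on $\mathfrak{g}$.
   Context: $\mathbf{k}$ is a field of characteristic $0$. An extended Rota-Baxter operator of weight $(\mu,\lambda)$ on a Lie algebra $(\mathfrak{g},\pi=[-,-])$ is a linear map $T:\mathfrak{g}\to\mathfrak{g}$ with $[T(u),T(v)]=T([T(u),v]+[u,T(v)]+\mu[u,v])+\lambda[u,v]$ for all $u,v$. $\mathrm{Hom}(\bigwedge\mathfrak{g},\mathfrak{g})=\bigoplus_{n\ge-1}\mathrm{Hom}(\wedge^{n+1}\mathfrak{g},\mathfrak{g})$, where $f\in\mathrm{Hom}(\wedge^{n+1}\mathfrak{g},\mathfrak{g})$ has degree $|f|=n$. $\mathrm{Sh}(i_1,\dots,i_r)$ is the set of permutations increasing on consecutive blocks of sizes $i_1,\dots,i_r$ (sums with a negative block size are zero). $(P\bar\circ Q)(x_1,\dots,x_{p+q+1})=\sum_{\sigma\in\mathrm{Sh}(q+1,p)}\mathrm{sgn}(\sigma)P(Q(x_{\sigma(1)},\dots,x_{\sigma(q+1)}),x_{\sigma(q+2)},\dots,x_{\sigma(p+q+1)})$ for $|P|=p,|Q|=q$.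 The curved dg Lie algebra structure is: $d_0(1)=-\lambda\pi$; $d_1(f)=(-1)^{|f|+1}\mu\,f\bar\circ\pi$; and for $f\in\mathrm{Hom}(\wedge^{n+1}\mathfrak{g},\mathfrak{g})$, $g\in\mathrm{Hom}(\wedge^{m+1}\mathfrak{g},\mathfrak{g})$, $$d_2(f,g)(x_1,\dots,x_{m+n+2})=\sum_{\sigma\in\mathrm{Sh}(n+1,m+1)}\mathrm{sgn}(\sigma)(-1)^{(n+1)m}\pi(f(x_{\sigma(1)},\dots,x_{\sigma(n+1)}),g(x_{\sigma(n+2)},\dots,x_{\sigma(n+m+2)}))$$ $$-(-1)^{(n+1)m}\sum_{\sigma\in\mathrm{Sh}(n+1,1,m)}\mathrm{sgn}(\sigma)g(\pi(f(x_{\sigma(1)},\dots,x_{\sigma(n+1)}),x_{\sigma(n+2)}),x_{\sigma(n+3)},\dots,x_{\sigma(n+m+2)})$$ $$-(-1)^{n}\sum_{\sigma\in\mathrm{Sh}(m+1,1,n)}\mathrm{sgn}(\sigma)f(\pi(g(x_{\sigma(1)},\dots,x_{\sigma(m+1)}),x_{\sigma(m+2)}),x_{\sigma(m+3)},\dots,x_{\sigma(n+m+2)}).$$ A Maurer-Cartan element of a curved dg Lie algebra $(L,d_0,d_1,d_2)$ is a degree $0$ element $\alpha$ with $d_0(1)+d_1(\alpha)+\frac12d_2(\alpha,\alpha)=0$. *)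

(* Defs.v *)
From HB Require Import structures.
From mathcomp Require Import all_boot all_order all_algebra all_fingroup.
From mathcomp Require Import boolp functions.

Set Implicit Arguments.
Unset Strict Implicit.
Unset Printing Implicit Defensive.

Import Order.TTheory GRing.Theory Num.Theory.
Local Open Scope ring_scope.

Record lie_bracket (k : fieldType) (g : lmodType k) := LieBracket {
  lie_bilinear :> {bilinear g -> g -> g};
  lie_alternating : forall x : g, lie_bilinear x x = 0;
  lie_jacobi : forall x y z : g,
    lie_bilinear x (lie_bilinear y z) + lie_bilinear y (lie_bilinear z x)
      + lie_bilinear z (lie_bilinear x y) = 0 }.

Definition extended_rota_baxter (k : fieldType) (g : lmodType k)
    (pi : lie_bracket g) (mu lambda : k) (T : {linear g -> g}) : Prop :=
  forall u v : g,
    pi (T u) (T v)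
    = T (pi (T u) v + pi u (T v) + mu *: pi u v) + lambda *: pi u v.

(* Permutations of {0, .., n-1} that are increasing on the consecutive blocks
   whose sizes are listed in [s]; there are none if some size is negative. *)
Definition Sh n (s : seq int) : {set 'S_n} :=
  let block := reshape_index [seq `|z|%N | z <- s] in
  [set sigma : 'S_n | all (fun z => 0 <= z) s &&
    [forall i : 'I_n, forall j : 'I_n,
       ((i < j)%N && (block i == block j)) ==> (sigma i < sigma j)%N]].

Section Multilinear.
Variables (k : fieldType) (g : lmodType k) (n : nat).

Definition multilinear (f : ('I_n -> g) -> g) : Prop :=
  forall x i (c : k) u v,
    f [eta x with i |-> c *: u + v]
    = c *: f [eta x with i |-> u] + f [eta x with i |-> v].

Definition alternating (f : ('I_n -> g) -> g) : Prop :=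
  forall x (i j : 'I_n), i != j -> x i = x j -> f x = 0.

Definition altmx : {pred (('I_n -> g) -> g)} :=
  fun f => `[< multilinear f /\ alternating f >].

Lemma altmxP f : reflect (multilinear f /\ alternating f) (f \in altmx).
Proof. exact: asboolP. Qed.

Lemma altmx_submod_closed : submod_closed altmx.
Proof.
split=> [|c f h /altmxP[fM fA] /altmxP[hM hA]]; apply/altmxP; split=> //.
- by move=> x i c u v /=; rewrite scaler0 addr0.
- move=> x i d u v; rewrite !fctE fM hM !scalerDr !scalerA (mulrC c d).
  by rewrite addrACA.
- by move=> x i j ij xij; rewrite !fctE (fA _ _ _ ij xij) (hA _ _ _ ij xij)
    scaler0 addr0.
Qed.

HB.instance Definition _ :=
  GRing.isSubmodClosed.Build k (('I_n -> g) -> g) altmx altmx_submod_closed.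
End Multilinear.

(* Hom(wedge^n g, g), as the module of alternating n-linear maps. *)
Record hom_wedge (k : fieldType) (g : lmodType k) (n : nat) := HomWedge {
  hom_fun :> ('I_n -> g) -> g;
  hom_altmx : hom_fun \in @altmx k g n }.

HB.instance Definition _ k g n := [isSub for @hom_fun k g n].
HB.instance Definition _ k g n := [Choice of @hom_wedge k g n by <:].
HB.instance Definition _ k g n :=
  [SubChoice_isSubLmodule of @hom_wedge k g n by <:].

Section AlternationLemmas.
Variables (k : fieldType) (g : lmodType k).

Definition lin_at n (i : nat) (c : k) (X Y Z : 'I_n -> g) : Prop :=
  forall j : 'I_n,
    if j == i :> nat then X j = c *: Y j + Z j else X j = Y j /\ X j = Z j.

Lemma multilinearP n (f : ('I_n -> g) -> g) : multilinear f <->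
  (forall (i : 'I_n) c X Y Z, lin_at i c X Y Z -> f X = c *: f Y + f Z).
Proof.
split=> [fM i c X Y Z XYZ | fM x i c u v]; last first.
  by apply: (fM i) => j /=; rewrite -!val_eqE /=; case: (nat_of_ord j == i).
have -> : X = [eta X with i |-> c *: Y i + Z i].
  apply/funext => j /=; case: eqP => // ->.
  by have:= XYZ i; rewrite eqxx.
rewrite fM; congr (_ *: f _ + f _); apply/funext => j /=;
  by have := XYZ j; rewrite val_eqE; case: (eqVneq j i) => [->|_ []].
Qed.

Lemma adjacent_alternating n (f : ('I_n -> g) -> g) :
  multilinear f ->
  (forall x (i j : 'I_n), j = i.+1 :> nat -> x i = x j -> f x = 0) ->
  alternating f.
Proof.
move=> fM fA.
have fD x i u v : f [eta x with i |-> u + v]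
    = f [eta x with i |-> u] + f [eta x with i |-> v].
  by have := fM x i 1 u v; rewrite !scale1r.
have sw x (i j : 'I_n) : j = i.+1 :> nat -> f (x \o tperm i j) = - f x.
  move=> ji; have ij : i != j by rewrite -val_eqE /= ji neq_ltn ltnSn.
  pose G u v := f [eta [eta x with j |-> v] with i |-> u].
  have Guu u : G u u = 0 by apply: (fA _ i j) => //=; rewrite eqxx eq_sym (negPf ij) eqxx.
  have GDl u u' v : G (u + u') v = G u v + G u' v by rewrite /G fD.
  have swp u v : ([eta [eta x with j |-> v] with i |-> u] : 'I_n -> g)
               = [eta [eta x with i |-> u] with j |-> v].
    apply/funext => z /=; case: (eqVneq z i) => [->|//].
    by rewrite (negPf ij).
  have GDr u v v' : G u (v + v') = G u v + G u v' by rewrite /G !swp fD.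
  have -> : f (x \o tperm i j) = G (x j) (x i).
    congr f; apply/funext => z /=; case: tpermP => [->|->|/eqP zi /eqP zj].
    - by rewrite eqxx.
    - by rewrite eq_sym (negPf ij) eqxx.
    - by rewrite (negPf zi) (negPf zj).
  have -> : f x = G (x i) (x j).
    congr f; apply/funext => z /=; case: eqP => [->//|_].
    by case: eqP => [->|].
  have := Guu (x i + x j); rewrite GDl !GDr !Guu add0r addr0.
  by rewrite addrC => /eqP; rewrite addr_eq0 => /eqP.
have main d : forall x (i j : 'I_n), j = (i + d).+1 :> nat -> x i = x j -> f x = 0.
  elim: d => [|d IH] x i j ji xij; first by apply: fA xij; rewrite ji addn0.
  have lt : ((i + d).+1 < n)%N by have := ltn_ord j; rewrite ji addnS; apply: ltnW.
  pose m := Ordinal lt.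
  apply/eqP; rewrite -oppr_eq0 -(sw x m j) ?ji ?addnS //; apply/eqP.
  apply: (IH _ i m) => //=; rewrite tpermL -xij tpermD //.
    by rewrite -val_eqE /= gtn_eqF // ltnS leq_addr.
  by rewrite -val_eqE /= ji gtn_eqF // ltnS leq_addr.
move=> x i j ij xij.
wlog lt : i j ij xij / (i < j)%N => [W|].
  move: (ij); rewrite -val_eqE neq_ltn => /orP[] /W; first exact.
  by apply=> //; rewrite eq_sym.
by apply: (main (j - i.+1)%N x i j) => //; rewrite -addSn subnKC.
Qed.

Lemma shuffle_sum_altmx n (s : seq int) (F : ('I_n -> g) -> g) (c : k) :
  let block := reshape_index [seq `|z|%N | z <- s] in
  (all (fun z => 0 <= z) s ->
    multilinear F /\
    (forall y (i j : 'I_n), (i < j)%N -> block i = block j -> y i = y j ->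
       F y = 0)) ->
  (fun x => \sum_(sigma in Sh n s) ((-1) ^+ sigma * c) *: F (x \o sigma))
    \in @altmx k g n.
Proof.
move=> block H.
case: (boolP (all (fun z => 0 <= z) s)) => [s0|s0]; last first.
  rewrite [fun _ => _](_ : _ = 0) ?rpred0 //.
  apply/funext => x; rewrite big1 // => sigma; rewrite inE (negPf s0).
  by [].
have {H} [/multilinearP FM FA] := H s0.
have SM : multilinear (fun x => \sum_(sigma in Sh n s) ((-1) ^+ sigma * c) *: F (x \o sigma)).
  apply/multilinearP => i d X Y Z XYZ.
  rewrite scaler_sumr -big_split; apply: eq_bigr => sigma _ /=.
  rewrite [d *: (_ *: _)]scalerA (mulrC d) -[(_ * d) *: _]scalerA -scalerDr; congr (_ *: _).
  apply: (FM ((sigma^-1)%g i)) => j /=.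
  have := XYZ (sigma j); rewrite !val_eqE (canF_eq (permK sigma)) //.
apply/altmxP; split=> //; apply: adjacent_alternating => // x i j ji xij.
pose t := tperm i j.
pose P (sigma : 'S_n) := block ((sigma^-1)%g i) == block ((sigma^-1)%g j).
have ij : i != j by rewrite -val_eqE /= ji neq_ltn ltnSn.
rewrite (bigID P) /= big1 ?add0r => [|sigma /andP[_ /eqP Ps]]; last first.
  have E: F (x \o sigma) = 0; last by rewrite E scaler0.
  case: (ltngtP ((sigma^-1)%g i) ((sigma^-1)%g j)) => [lt|lt|/val_inj/perm_inj /eqP].
  - by apply: FA lt Ps _; rewrite /= !permKV.
  - by apply: FA lt (esym Ps) _; rewrite /= !permKV.
  - by rewrite (negPf ij).
have Sht sigma : sigma \in Sh n s -> ~~ P sigma -> (sigma * t)%g \in Sh n s.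
  rewrite !inE => /andP[-> /forallP Hs] nP /=.
  apply/forallP => a; apply/forallP => b; apply/implyP => /andP[ab bab].
  have := Hs a => /forallP/(_ b); rewrite ab bab /= !permM => lt.
  have nab : ~ (sigma a = i /\ sigma b = j).
    by case=> ea eb; case/negP: nP; rewrite /P -ea -eb !permK.
  rewrite /t; case: (tpermP i j (sigma a)) => [ea|ea|nai naj];
    case: (tpermP i j (sigma b)) => [eb|eb|nbi nbj]; move: lt;
    rewrite ?ea ?eb ?ji ?ltnn //.
  - by case: nab.
  - by rewrite leq_eqVlt -ji => /orP[/eqP/val_inj e|//]; case: nbj.
  - by move/ltnW.
  - by move=> lt; rewrite ltnS ltnW.
  - rewrite ltnS leq_eqVlt => /orP[/eqP/val_inj e|//]; by case: nai.
have Pt sigma : P (sigma * t)%g = P sigma.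
  by rewrite /P invMg tpermV !permM tpermL tpermR eq_sym.
rewrite (bigID (fun sigma : 'S_n => odd_perm sigma)) /=.
rewrite (reindex_inj (mulIg t)) /=.
rewrite [X in X + _](eq_bigl (fun sigma : 'S_n => ((sigma \in Sh n s) && ~~ P sigma) && ~~ sigma)); last first.
  move=> sigma; rewrite Pt odd_permM odd_tperm ij addbT; congr (_ && _).
  case: (boolP (P sigma)) => nP; rewrite ?andbF // ?andbT.
  apply/idP/idP => H; last exact: Sht.
  by rewrite -[sigma]mulg1 -(tperm2 i j) -/t mulgA Sht // Pt.
rewrite -big_split big1 // => sigma _ /=.
have -> : x \o (sigma * t)%g = x \o sigma.
  apply/funext => z /=; rewrite permM /t; case: tpermP => [->|->|] //.
rewrite odd_permM odd_tperm ij addbT -scalerDl -mulrDl.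
by case: (odd_perm sigma); rewrite /= ?expr0 ?expr1 ?subrr ?addNr ?addrN mul0r scale0r.
Qed.
End AlternationLemmas.

Section Evaluation.
Variables (k : fieldType) (g : lmodType k).

Definition args n (x : 'I_n -> g) : seq g := [seq x i | i <- enum 'I_n].

(* Application of [f] to the first [n] entries of [s]. *)
Definition ev n (f : hom_wedge g n) (s : seq g) : g := f (fun i => s`_i).

Definition slin (i : nat) (c : k) (s1 s2 s3 : seq g) : Prop :=
  forall m, if m == i then s1`_m = c *: s2`_m + s3`_m
            else s1`_m = s2`_m /\ s1`_m = s3`_m.

Lemma nth_args n (x : 'I_n -> g) (i : 'I_n) : (args x)`_i = x i.
Proof. by rewrite (nth_map i) ?size_enum_ord // nth_ord_enum. Qed.

Lemma args_slin n i c (X Y Z : 'I_n -> g) : (i < n)%N ->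
  lin_at i c X Y Z -> slin i c (args X) (args Y) (args Z).
Proof.
move=> ltin XYZ m; case: (ltnP m n) => [lt|le].
  by have := XYZ (Ordinal lt); rewrite -!nth_args.
by rewrite gtn_eqF ?(leq_trans ltin) // !nth_default // size_map size_enum_ord.
Qed.

Lemma ev_slin n (f : hom_wedge g n) i c s1 s2 s3 : (i < n)%N ->
  slin i c s1 s2 s3 -> ev f s1 = c *: ev f s2 + ev f s3.
Proof.
move=> lt H; have /altmxP[/multilinearP fM _] := hom_altmx f.
by apply: (fM (Ordinal lt)) => j /=; apply: H.
Qed.

Lemma eq_ev n (f : hom_wedge g n) s1 s2 :
  (forall m, (m < n)%N -> s1`_m = s2`_m) -> ev f s1 = ev f s2.
Proof. by move=> H; congr (f _); apply/funext => i; apply: H. Qed.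

Lemma ev_alt n (f : hom_wedge g n) i j s :
  (i < j)%N -> (j < n)%N -> s`_i = s`_j -> ev f s = 0.
Proof.
move=> ij jn sij; have /altmxP[_ fA] := hom_altmx f.
apply: (fA _ (Ordinal (ltn_trans ij jn)) (Ordinal jn)) => //.
by rewrite -val_eqE /= ltn_eqF.
Qed.

Lemma ev0 n (f : hom_wedge g n) i s : (i < n)%N -> s`_i = 0 -> ev f s = 0.
Proof.
move=> lt s0; have := @ev_slin n f i (-1) s s s lt.
rewrite scaleN1r addNr; apply=> m; case: eqP => // ->.
by rewrite s0 scaler0 addr0.
Qed.

Lemma slin_take i c s1 s2 s3 a :
  slin i c s1 s2 s3 -> (i < a)%N -> slin i c (take a s1) (take a s2) (take a s3).
Proof.
move=> H lt m; case: (ltnP m a) => [ma|am].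
  by rewrite !nth_take //; apply: H.
rewrite gtn_eqF ?(leq_trans lt) // !nth_default //;
  by rewrite size_take_min (leq_trans (geq_minl _ _)).
Qed.

Lemma slin_drop i c s1 s2 s3 a :
  slin i c s1 s2 s3 -> (a <= i)%N ->
  slin (i - a) c (drop a s1) (drop a s2) (drop a s3).
Proof.
move=> H le m; rewrite !nth_drop.
by have := H (a + m)%N; rewrite -{1}(subnKC le) eqn_add2l.
Qed.

Lemma slin_nth i c s1 s2 s3 m : slin i c s1 s2 s3 -> m != i ->
  s1`_m = s2`_m /\ s1`_m = s3`_m.
Proof. by move=> H ne; have := H m; rewrite (negPf ne). Qed.

Lemma slin_head c x1 x2 x3 (s1 s2 s3 : seq g) :
  x1 = c *: x2 + x3 -> (forall m, s1`_m = s2`_m /\ s1`_m = s3`_m) ->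
  slin 0 c (x1 :: s1) (x2 :: s2) (x3 :: s3).
Proof. by move=> H H' [|m] //=; apply: H'. Qed.

Lemma slin_cons c i x (s1 s2 s3 : seq g) :
  slin i c s1 s2 s3 -> slin i.+1 c (x :: s1) (x :: s2) (x :: s3).
Proof. by move=> H [|m] //=; rewrite eqSS; apply: H. Qed.

Lemma slin_ev_take n (f : hom_wedge g n) i c s1 s2 s3 :
  slin i c s1 s2 s3 -> (n <= i)%N ->
  ev f (take n s1) = ev f (take n s2) /\ ev f (take n s1) = ev f (take n s3).
Proof.
move=> H le; split; apply: eq_ev => m lt; rewrite !nth_take //;
  by case: (slin_nth H (m := m)) => //; rewrite ltn_eqF // (leq_trans lt).
Qed.

Lemma slin_drop_lt i c s1 s2 s3 a m : slin i c s1 s2 s3 -> (i < a)%N ->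
  (drop a s1)`_m = (drop a s2)`_m /\ (drop a s1)`_m = (drop a s3)`_m.
Proof.
by move=> H lt; rewrite !nth_drop; apply: (slin_nth H); rewrite gtn_eqF // ltn_addr.
Qed.

Lemma nth_args_eq n (y : 'I_n -> g) (i j : 'I_n) :
  y i = y j -> (args y)`_i = (args y)`_j.
Proof. by rewrite !nth_args. Qed.

Lemma nested_slin p q (P : hom_wedge g p.+1) (Q : hom_wedge g q) i c s1 s2 s3 :
  (i < q + p)%N -> slin i c s1 s2 s3 ->
  let F s := ev P (ev Q (take q s) :: drop q s) in F s1 = c *: F s2 + F s3.
Proof.
move=> lt H /=; case: (ltnP i q) => [iq|qi].
  apply: (ev_slin P (i := 0%N)) => //; apply: slin_head.
    by apply: (ev_slin Q iq); apply: slin_take.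
  by move=> m; apply: slin_drop_lt H iq.
have [e2 e3] := slin_ev_take Q H qi; rewrite -e2 -e3.
apply: (ev_slin P (i := (i - q).+1)); first by rewrite ltnS ltn_subLR.
exact/slin_cons/slin_drop.
Qed.

Lemma nested_alt p q (P : hom_wedge g p.+1) (Q : hom_wedge g q) i j s :
  (i < j)%N -> (j < q + p)%N -> (i < q)%N = (j < q)%N -> s`_i = s`_j ->
  ev P (ev Q (take q s) :: drop q s) = 0.
Proof.
move=> ij lt; case: (ltnP j q) => [jq iq|qj].
  move=> sij; apply: (ev0 P (i := 0%N)) => //=.
  by apply: (ev_alt Q (i := i) (j := j)) => //; rewrite !nth_take.
move/negbT; rewrite -leqNgt => qi sij.
apply: (ev_alt P (i := (i - q).+1) (j := (j - q).+1)).
- by rewrite ltnS ltn_sub2r // (leq_ltn_trans qi).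
- by rewrite ltnS ltn_subLR.
- by rewrite /= !nth_drop !subnKC.
Qed.

Variable pi : lie_bracket g.

Lemma nested3_slin p q (P : hom_wedge g p.+1) (Q : hom_wedge g q) i c s1 s2 s3 :
  (i < q + p.+1)%N -> slin i c s1 s2 s3 ->
  let F s := ev P (pi (ev Q (take q s)) s`_q :: drop q.+1 s) in
  F s1 = c *: F s2 + F s3.
Proof.
move=> lt H /=; case: (ltngtP i q) => [iq|qi|iq].
- have [<- <-] := slin_nth H (m := q) (negbT (gtn_eqF iq)).
  apply: (ev_slin P (i := 0%N)) => //; apply: slin_head.
    by rewrite -linearPl; congr (pi _ _); apply: (ev_slin Q iq); apply: slin_take.
  by move=> m; apply: slin_drop_lt H (ltnW _).
- have [e2 e3] := slin_ev_take Q H (ltnW qi); rewrite -e2 -e3.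
  have [<- <-] := slin_nth H (m := q) (negbT (ltn_eqF qi)).
  apply: (ev_slin P (i := (i - q.+1).+1)); first by rewrite ltnS ltn_subLR // addSnnS.
  exact/slin_cons/slin_drop.
- have [e2 e3] := slin_ev_take Q H (eq_leq (esym iq)); rewrite -e2 -e3.
  apply: (ev_slin P (i := 0%N)) => //; apply: slin_head.
    by have := H q; rewrite iq eqxx => ->; rewrite linearPr.
  by move=> m; apply: slin_drop_lt H _; rewrite iq.
Qed.

Lemma nested3_alt p q (P : hom_wedge g p.+1) (Q : hom_wedge g q) i j s :
  (i < j)%N -> (j < q + p.+1)%N -> (i < q)%N = (j < q)%N ->
  (i < q.+1)%N = (j < q.+1)%N -> s`_i = s`_j ->
  ev P (pi (ev Q (take q s)) s`_q :: drop q.+1 s) = 0.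
Proof.
move=> ij lt; case: (ltnP j q) => [jq iq _ sij|qj].
  apply: (ev0 P (i := 0%N)) => //=.
  rewrite (ev_alt Q (i := i) (j := j)) ?linear0l // !nth_take //.
move/negbT; rewrite -leqNgt => qi.
rewrite [RHS]ltnNge (leq_ltn_trans qi ij) => /negbT; rewrite -leqNgt => qi' sij.
apply: (ev_alt P (i := (i - q.+1).+1) (j := (j - q.+1).+1)).
- by rewrite ltnS ltn_sub2r // (leq_ltn_trans qi').
- by rewrite ltnS ltn_subLR ?(leq_ltn_trans qi) // addSnnS.
- by rewrite /= !nth_drop !subnKC // (leq_ltn_trans qi).
Qed.

Lemma product_slin a b (f : hom_wedge g a) (h : hom_wedge g b) i c s1 s2 s3 :
  (i < a + b)%N -> slin i c s1 s2 s3 ->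
  let F s := pi (ev f (take a s)) (ev h (drop a s)) in F s1 = c *: F s2 + F s3.
Proof.
move=> lt H /=; case: (ltnP i a) => [ia|ai].
  rewrite (ev_slin f ia (slin_take H ia)) linearPl.
  congr (_ *: pi _ _ + pi _ _); apply: eq_ev => m _;
    by have [] := slin_drop_lt m H ia.
have [<- <-] := slin_ev_take f H ai; rewrite -linearPr; congr (pi _ _).
by apply: ev_slin (slin_drop H ai); rewrite ltn_subLR.
Qed.

Lemma product_alt a b (f : hom_wedge g a) (h : hom_wedge g b) i j s :
  (i < j)%N -> (j < a + b)%N -> (i < a)%N = (j < a)%N -> s`_i = s`_j ->
  pi (ev f (take a s)) (ev h (drop a s)) = 0.
Proof.
move=> ij lt; case: (ltnP j a) => [ja ia sij|aj].
  by rewrite (ev_alt f ij) ?linear0l // !nth_take.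
move/negbT; rewrite -leqNgt => ai sij.
rewrite (ev_alt h (i := (i - a)%N) (j := (j - a)%N)) ?linear0r //.
- by rewrite ltn_sub2r // (leq_ltn_trans ai).
- by rewrite ltn_subLR.
- by rewrite !nth_drop !subnKC.
Qed.

Lemma block2 (a b : nat) (i j : nat) :
  reshape_index [:: a; b] i = reshape_index [:: a; b] j -> (i < a)%N = (j < a)%N.
Proof.
by rewrite /reshape_index /= !subn_eq0; case: (i < a)%N; case: (j < a)%N.
Qed.

Lemma block3 (a b : nat) (i j : nat) :
  reshape_index [:: a; 1%N; b] i = reshape_index [:: a; 1%N; b] j ->
  (i < a)%N = (j < a)%N /\ (i < a.+1)%N = (j < a.+1)%N.
Proof.
rewrite /reshape_index /= !subn_eq0 !leq_subLR !addn1 !(ltnS _ a).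
case: (ltnP i a) (ltnP j a) => [ia|ia] [ja|ja] //=; first by rewrite (ltnW ia) (ltnW ja).
by case: (i <= a)%N; case: (j <= a)%N.
Qed.
End Evaluation.

Section CurvedDgLie.
Variables (k : fieldType) (g : lmodType k).

(* The degree of the elements of Hom(wedge^a g, g). *)
Definition deg (a : nat) : int := a%:Z - 1.

(* The composition written "P o-bar Q": Q is inserted in the first argument of
   P. For a = 0 the second block size is -1 and the sum is empty. *)
Definition circ_fun a b (P : hom_wedge g a) (Q : hom_wedge g b)
    (x : 'I_(b + a).-1 -> g) : g :=
  \sum_(sigma in Sh (b + a).-1 [:: b%:Z; deg a])
    let s := args (x \o sigma) in
    (-1) ^+ sigma *: ev P (ev Q (take b s) :: drop b s).

Lemma circ_altmx a b (P : hom_wedge g a) (Q : hom_wedge g b) :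
  circ_fun P Q \in @altmx k g (b + a).-1.
Proof.
pose F (y : 'I_(b + a).-1 -> g) := ev P (ev Q (take b (args y)) :: drop b (args y)).
have -> : circ_fun P Q = fun x => \sum_(sigma in Sh (b + a).-1 [:: b%:Z; deg a])
    ((-1) ^+ sigma * 1) *: F (x \o sigma).
  by apply/funext => x; apply: eq_bigr => sigma _; rewrite mulr1.
apply: (@shuffle_sum_altmx k g _ _ F 1); rewrite {}/F.
case: a P => [//|p] P _; split.
  apply/multilinearP => i c X Y Z XYZ.
  have lt : (i < b + p)%N by have := ltn_ord i; rewrite [in X in (_ < X)%N]addnS.
  exact: nested_slin lt (args_slin (ltn_ord i) XYZ).
move=> y i j ij /block2 bij /nth_args_eq; apply: nested_alt => //.
by have := ltn_ord j; rewrite [in X in (_ < X)%N]addnS.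
Qed.

Definition circ a b (P : hom_wedge g a) (Q : hom_wedge g b) :
  hom_wedge g (b + a).-1 := HomWedge (circ_altmx P Q).

Lemma linear_altmx (T : {linear g -> g}) :
  (fun x : 'I_1 -> g => T (x ord0)) \in @altmx k g 1.
Proof.
apply/altmxP; split=> [x i c u v | x i j]; last by rewrite !ord1 eqxx.
by rewrite /= !ord1 eqxx linearP.
Qed.

Definition hom_of_linear (T : {linear g -> g}) : hom_wedge g 1 :=
  HomWedge (linear_altmx T).

Variables (pi : lie_bracket g) (mu lambda : k).

Lemma bracket_altmx :
  (fun x : 'I_2 -> g => pi (x ord0) (x ord_max)) \in @altmx k g 2.
Proof.
apply/altmxP; split=> [x i c u v | x i j ij xij].
  by case: i => [[|[|//]] lt] /=; rewrite ?linearPl ?linearPr.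
suff -> : x ord0 = x ord_max by rewrite lie_alternating.
have o2 (m : 'I_2) : m = ord0 \/ m = ord_max.
  by case: m => [[|[|//]] lt]; [left | right]; apply: val_inj.
by case: (o2 i) ij xij => ->; case: (o2 j) => ->; rewrite ?eqxx.
Qed.

Definition hom_of_bracket : hom_wedge g 2 := HomWedge bracket_altmx.

Definition d0 (t : k) : hom_wedge g 2 := t *: - (lambda *: hom_of_bracket).

Definition d1 a (f : hom_wedge g a) : hom_wedge g a.+1 :=
  ((-1) ^ (deg a + 1) * mu) *: circ f hom_of_bracket.

Definition d2_fun a b (f : hom_wedge g a) (h : hom_wedge g b)
    (x : 'I_(a + b) -> g) : g :=
  \sum_(sigma in Sh (a + b) [:: a%:Z; b%:Z])
    (let s := args (x \o sigma) in
     ((-1) ^+ sigma * (-1) ^ (a%:Z * deg b))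
       *: pi (ev f (take a s)) (ev h (drop a s)))
  - (-1) ^ (a%:Z * deg b) *: (\sum_(sigma in Sh (a + b) [:: a%:Z; 1; deg b])
    let s := args (x \o sigma) in
    (-1) ^+ sigma *: ev h (pi (ev f (take a s)) s`_a :: drop a.+1 s))
  - (-1) ^ deg a *: (\sum_(sigma in Sh (a + b) [:: b%:Z; 1; deg a])
    let s := args (x \o sigma) in
    (-1) ^+ sigma *: ev f (pi (ev h (take b s)) s`_b :: drop b.+1 s)).

Lemma nested3_altmx n a b (P : hom_wedge g a) (Q : hom_wedge g b) :
  n = (b + a)%N ->
  (fun x => \sum_(sigma in Sh n [:: b%:Z; 1; deg a])
    let s := args (x \o sigma) in
    (-1) ^+ sigma *: ev P (pi (ev Q (take b s)) s`_b :: drop b.+1 s))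
  \in @altmx k g n.
Proof.
move=> nE; set G := fun _ => _.
pose F (y : 'I_n -> g) := ev P (pi (ev Q (take b (args y))) (args y)`_b
                    :: drop b.+1 (args y)).
have {G} -> : G = fun x => \sum_(sigma in Sh n [:: b%:Z; 1; deg a])
    ((-1) ^+ sigma * 1) *: F (x \o sigma).
  by apply/funext => x; apply: eq_bigr => sigma _; rewrite mulr1.
apply: (@shuffle_sum_altmx k g _ _ F 1); rewrite {}/F.
case: a P nE => [//|p] P nE _; split.
  apply/multilinearP => i c X Y Z XYZ.
  have lt : (i < b + p.+1)%N by rewrite -nE.
  exact: nested3_slin lt (args_slin (ltn_ord i) XYZ).
move=> y i j ij /block3[bij bij'] /nth_args_eq.
by apply: nested3_alt => //; rewrite -nE.
Qed.

Lemma d2_altmx a b (f : hom_wedge g a) (h : hom_wedge g b) :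
  d2_fun f h \in @altmx k g (a + b).
Proof.
pose F (y : 'I_(a + b) -> g) := pi (ev f (take a (args y))) (ev h (drop a (args y))).
have A1 : (fun x => \sum_(sigma in Sh (a + b) [:: a%:Z; b%:Z])
    ((-1) ^+ sigma * (-1) ^ (a%:Z * deg b)) *: F (x \o sigma))
    \in @altmx k g (a + b).
  apply: (@shuffle_sum_altmx k g _ _ F); rewrite {}/F => _; split.
    apply/multilinearP => i c X Y Z XYZ.
    exact: product_slin (ltn_ord i) (args_slin (ltn_ord i) XYZ).
  move=> y i j ij /block2 bij /nth_args_eq; exact: product_alt.
have A2 := nested3_altmx h f (erefl (a + b)%N).
have A3 := nested3_altmx f h (addnC a b).
have B2 := @rpredZ _ _ (@altmx k g (a + b)) ((-1) ^ (a%:Z * deg b)) _ A2.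
have B3 := @rpredZ _ _ (@altmx k g (a + b)) ((-1) ^ deg a) _ A3.
exact: rpredB (rpredB A1 B2) B3.
Qed.

Definition d2 a b (f : hom_wedge g a) (h : hom_wedge g b) :
  hom_wedge g (a + b) := HomWedge (d2_altmx f h).

Definition homs (n : nat) : lmodType k := hom_wedge g n.
End CurvedDgLie.

(* [L a] is the homogeneous component of degree a - 1, so that [L 0] has degree
   -1, the degree 0 component is [L 1], d_0 and d_1 have degree 1, and d_2 maps
   degrees n, m to degree n + m + 1. The identities required of (d_0, d_1, d_2)
   in a curved dg Lie algebra do not enter this notion. *)
Definition maurer_cartan (k : fieldType) (L : nat -> lmodType k)
    (d0 : k -> L 2) (d1 : forall a, L a -> L a.+1)
    (d2 : forall a b, L a -> L b -> L (a + b)%N) (alpha : L 1) : Prop :=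
  d0 1 + d1 1%N alpha + 2%:R^-1 *: d2 1%N 1%N alpha alpha = 0.

(* Main.v *)
(* The Maurer-Cartan equation of T lives in Hom(wedge^2 g, g), where the only
   possible shuffles are the identity and the transposition. In d_2(T, T) the
   antisymmetry of the bracket makes every contribution occur twice, so
   (1/2) d_2(T, T) (u, v) = [Tu, Tv] - T([Tu, v] + [u, Tv]), while d_0(1) and
   d_1(T) evaluate to -lambda [u, v] and -mu T[u, v]. *)
Require Import Defs.
From mathcomp Require Import all_boot all_order all_algebra.
From mathcomp Require Import all_fingroup.
From mathcomp Require Import boolp functions.

Import GRing.Theory.
Local Open Scope ring_scope.

Lemma sum_perm2 (V : nmodType) (F : 'S_2 -> V) (A : {set 'S_2}) :
  \sum_(sigma in A) F sigma =
  (if 1%g \in A then F 1%g else 0)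
  + (if tperm ord0 ord_max \in A then F (tperm ord0 ord_max) else 0).
Proof.
have nt : (tperm ord0 ord_max : 'S_2) != 1%g.
  by apply/eqP => /permP/(_ ord0); rewrite tpermL perm1.
(* The identity and the transposition are split off. Any other [sigma] would give an empty
   remainder, since its two values are distinct elements of ['I_2]. *)
rewrite big_mkcond (bigD1 1%g) //= (bigD1 (tperm ord0 ord_max)) //=.
rewrite big1 ?addr0 // => sigma /andP[n1 nt2].
have o2 (m : 'I_2) : m = ord0 \/ m = ord_max.
  by case: m => [[|[|//]] lt]; [left | right]; apply: val_inj.
have ne : sigma ord0 != sigma ord_max by rewrite (inj_eq perm_inj).
case: (o2 (sigma ord0)) (o2 (sigma ord_max)) ne => e0 [] e1; rewrite e0 e1 // => _.
  case/eqP: n1; apply/permP => i.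
  by case: (o2 i) => ->; rewrite perm1 ?e0 ?e1.
case/eqP: nt2; apply/permP => i.
by case: (o2 i) => ->; rewrite ?tpermL ?tpermR ?e0 ?e1.
Qed.

Lemma one_Sh n (s : seq int) :
  (1%g \in Sh n s) = all (fun z => 0 <= z) s.
Proof.
rewrite inE andbC; case: forallP => // -[] i; apply/forallP => j.
by rewrite !perm1; apply/implyP => /andP[].
Qed.

(** The only pair [i < j] in ['I_2] is (0, 1), and the transposition reverses it, so the shuffle
    condition can hold only vacuously. *)
Lemma tperm_Sh2 (s : seq int) :
  (tperm ord0 ord_max \in Sh 2 s) =
  all (fun z => 0 <= z) s
  && (reshape_index [seq `|z|%N | z <- s] 0
      != reshape_index [seq `|z|%N | z <- s] 1).
Proof.
rewrite inE; congr andb; apply/forallP/idP => [/(_ ord0)/forallP/(_ ord_max)|ne i].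
  by rewrite tpermL tpermR /= implybF.
apply/forallP => j; apply/implyP => /andP[ij] /eqP eb; move: ne.
by case: i j ij eb => [[|[|//]] ?] [[|[|//]] ?] //= _ ->; rewrite eqxx.
Qed.

(** Polarization of the alternating law at [x + y]. *)
Lemma lie_anticomm (k : fieldType) (g : lmodType k) (pi : lie_bracket g) x y :
  pi x y = - pi y x.
Proof.
have := lie_alternating pi (x + y).
rewrite linearDl !linearDr !lie_alternating add0r addr0 => /eqP.
by rewrite addr_eq0 => /eqP.
Qed.

Section MaurerCartanTerms.
Variables (k : fieldType) (g : lmodType k) (pi : lie_bracket g).
Variables (mu lambda : k) (T : {linear g -> g}) (x : 'I_2 -> g).

Lemma args_perm2_0 (s : 'S_2) : (args (x \o s))`_0 = x (s ord0).
Proof. exact: (nth_args (x \o s) ord0). Qed.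

Lemma args_perm2_1 (s : 'S_2) : (args (x \o s))`_1 = x (s ord_max).
Proof. exact: (nth_args (x \o s) ord_max). Qed.

Lemma d0_linear :
  d0 pi lambda 1 x = - (lambda *: pi (x ord0) (x ord_max)).
Proof. by rewrite /d0 scale1r. Qed.

Lemma d1_linear :
  d1 pi mu (hom_of_linear T) x = - (mu *: T (pi (x ord0) (x ord_max))).
Proof.
have -> : d1 pi mu (hom_of_linear T) x
    = ((-1) ^ (deg 1 + 1) * mu) *: circ_fun (hom_of_linear T) (hom_of_bracket pi) x.
  by [].
(* The block sizes are 2 and 0: both positions share a block, so only the identity survives. *)
rewrite /circ_fun /= (@sum_perm2 g) one_Sh tperm_Sh2 /= addr0.
rewrite odd_perm1 scale1r /ev /= !nth_take //.
rewrite args_perm2_0 args_perm2_1 !perm1.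
by rewrite expr1z mulN1r scaleNr.
Qed.

Lemma d2_linear :
  d2 pi (hom_of_linear T) (hom_of_linear T) x
  = 2%:R *: (pi (T (x ord0)) (T (x ord_max))
     - T (pi (T (x ord0)) (x ord_max) + pi (x ord0) (T (x ord_max)))).
Proof.
have -> : d2 pi (hom_of_linear T) (hom_of_linear T) x
  = d2_fun pi (hom_of_linear T) (hom_of_linear T) x by [].
(* Block sizes (1, 1) and (1, 1, 0) separate the two positions, so both permutations occur in each
   of the three sums. *)
rewrite /d2_fun !(@sum_perm2 g) !one_Sh !tperm_Sh2 /=.
rewrite odd_perm1 odd_tperm /= /ev /= !nth_drop !nth_take //.
rewrite addn0 !args_perm2_0 !args_perm2_1 !perm1 tpermL tpermR.
(* Since [deg 1] is 0, the degree signs are trivial; only the sign of the transposition remains. *)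
rewrite !expr0z !mulr1 expr0 expr1 !scale1r !scaleN1r.
rewrite (lie_anticomm _ _ pi (T (x ord_max)) (T (x ord0))).
rewrite (lie_anticomm _ _ pi (T (x ord_max)) (x ord0)).
rewrite -(linearB T) !opprK scaler_nat mulr2n.
by rewrite -addrA -opprD addrACA -opprD.
Qed.
End MaurerCartanTerms.

Theorem theorem3p11 (k : fieldType) (char0 : [pchar k] =i pred0)
    (g : lmodType k) (pi : lie_bracket g) (mu lambda : k)
    (T : {linear g -> g}) :
  maurer_cartan (L := homs g) (d0 pi lambda) (d1 pi mu) (d2 pi)
    (hom_of_linear T)
  <-> extended_rota_baxter pi mu lambda T.
Proof.
(* Characteristic 0 lets the factor 1/2 cancel the 2 in [d2_linear]. *)
have two0 : 2%:R != 0 :> k by rewrite (pcharf0P k).1.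
pose mc : hom_wedge g 2 := d0 pi lambda 1 + d1 pi mu (hom_of_linear T)
  + 2%:R^-1 *: d2 pi (hom_of_linear T) (hom_of_linear T).
(* The left side of the Maurer-Cartan equation is the defect of the Rota-Baxter identity at
   [(x ord0, x ord_max)]. *)
have mcE x : mc x = pi (T (x ord0)) (T (x ord_max))
   - (T (pi (T (x ord0)) (x ord_max) + pi (x ord0) (T (x ord_max))
         + mu *: pi (x ord0) (x ord_max)) + lambda *: pi (x ord0) (x ord_max)).
  have -> : mc x = d0 pi lambda 1 x + d1 pi mu (hom_of_linear T) x
    + 2%:R^-1 *: d2 pi (hom_of_linear T) (hom_of_linear T) x by [].
  rewrite d0_linear d1_linear d2_linear scalerA mulVf // scale1r.
  rewrite (linearD T _ (mu *: _)) (linearZ_LR T) !opprD.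
  rewrite addrC -!addrA; congr (_ + (_ + _)); exact: addrC.
change (mc = 0 <-> extended_rota_baxter pi mu lambda T).
split=> [mc0 u v | rb].
  pose x (i : 'I_2) := if i == ord0 then u else v.
  by apply/eqP; rewrite -subr_eq0 -(mcE x) mc0.
(* An element of [hom_wedge] is determined by its values, so a pointwise check suffices. *)
apply/val_inj/funext => x; rewrite [LHS]mcE rb subrr; exact: erefl.
Qed.
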